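(* Let $X$ be a perfectly normal space. Let $C$ be a closed subset of $X$. Let $X'$ be the complement of $C$ in $X$ (with the subspace topology). Let $Y$ be a metric topological manifold, with metric $d$. Let $Z$ be an $X'$-avoidable subset of $Y$. Let $f$ be a continuous map from $X$ to $Y$. Let $\varepsilon$ be a continuous function from $X$ to $\mathbb{R}_{>0}$. Suppose that $f(x)\notin Z$ for all $x\in C$. Then there exists a continuous map $g$ from $X$ to $Y$ such that for all $x\in C$, $g(x)=f(x)$, and for all $x\in X$, $g(x)\notin Z$ and $d(f(x),g(x))<\varepsilon(x)$.
   Context: A space $X$ is perfectly normal if for any disjoint closed subsets $E,F$ of $X$ there exists a continuous function $\phi:X\to[0,1]$ such that $\phi(x)=0\Leftrightarrow x\in E$ and $\phi(x)=1\Leftrightarrow x\in F$. A manifold of dimension $p\in\mathbb{N}$ is a Hausdorff space where every point has a neighborhood homeomorphic to $\mathbb{R}^p$. A metric topological manifold is a metric space whose underlying topological space is a manifold. Avoidability: let $T$ be a topological space, $Y$ a metric space with metric $d$, and $Z\subset Y$. One says that $Z$ is $T$-avoidable (in $Y$) if for any continuous map $f:T\to Y$ and any continuous function $\varepsilon:T\to\mathbb{R}_{>0}$ there exists a continuous map $g:T\to Y$ such that for all $x\in T$, $g(x)\notin Z$ and $d(f(x),g(x))<\varepsilon(x)$. *)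

(* Defs.v *)
From HB Require Import structures.
From mathcomp Require Import all_boot all_order all_algebra.
From mathcomp Require Import all_classical all_reals all_analysis.

Set Implicit Arguments.
Unset Strict Implicit.
Unset Printing Implicit Defensive.

Import Order.TTheory GRing.Theory Num.Theory.
Import numFieldNormedType.Exports.

Local Open Scope classical_set_scope.
Local Open Scope ring_scope.

(* Maps into [0, 1] (and, below, into the positive reals) are real-valued maps
   with a range condition. *)
Definition perfectly_normal (R : realType) (X : topologicalType) : Prop :=
  forall E F : set X, closed E -> closed F -> E `&` F = set0 ->
  exists phi : X -> R,
    [/\ continuous phi,
        forall x, 0 <= phi x <= 1,
        forall x, phi x = 0 <-> E x &
        forall x, phi x = 1 <-> F x].

Definition homeomorphic (S T : topologicalType) : Prop :=
  exists (f : S -> T) (g : T -> S),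
    [/\ continuous f, continuous g, cancel f g & cancel g f].

(* [set_type V] carries the subspace topology; V need not be open, as in
   [nbhs]. Dimension p = 0 is allowed. *)
Definition manifold (R : realType) (p : nat) (M : topologicalType) : Prop :=
  hausdorff_space M /\
  forall x : M, exists2 V : set M,
    nbhs x V & homeomorphic (set_type V) 'rV[R]_p.

Definition avoidable (R : realType) (T : topologicalType) (Y : metricType R)
    (Z : set Y) : Prop :=
  forall (f : T -> Y) (eps : T -> R),
    continuous f -> continuous eps -> (forall x, 0 < eps x) ->
  exists2 g : T -> Y, continuous g &
    forall x, ~ Z (g x) /\ mdist (f x) (g x) < eps x.

Arguments avoidable {R} T {Y} Z.

(* Main.v *)
(** Let [phi] vanish exactly on [C]. Apply avoidability off [C] with the radius
    [min eps phi], which is positive there, and extend the resulting map by [f]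
    on [C]. Continuity at a point of [C] holds because [mdist (f x) (g x)] is at
    most [phi x], which tends to [0]. *)

Require Import Defs.
From HB Require Import structures.
From mathcomp Require Import all_boot all_order all_algebra.
From mathcomp Require Import all_classical all_reals all_analysis.

Set Implicit Arguments.
Unset Strict Implicit.
Unset Printing Implicit Defensive.

Import Order.TTheory GRing.Theory Num.Theory.
Import numFieldNormedType.Exports.

Local Open Scope classical_set_scope.
Local Open Scope ring_scope.

(** Perfect normality is applied to the disjoint pair [C], [set0]. *)
Lemma perfectly_normal_closed_zero (R : realType) (X : topologicalType)
    (C : set X) : perfectly_normal R X -> closed C ->
  exists phi : X -> R,
    [/\ continuous phi, forall x, 0 <= phi x & forall x, phi x = 0 <-> C x].
Proof.
move=> hX /hX /(_ closed0) /(_ (setI0 C)) [phi [phic phi01 phi0 _]].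
by exists phi; split => // x; have /andP[] := phi01 x.
Qed.

(** The bound at [x] forces [f x = g x]; near [x], the distance from [g x] to [g y] is then at most
    [mdist (f x) (f y) + phi y], and both terms tend to 0. *)
Lemma mdist_squeeze_continuous (R : realType) (X : topologicalType)
    (Y : metricType R) (f g : X -> Y) (phi : X -> R) (x : X) :
  {for x, continuous f} -> {for x, continuous phi} -> phi x = 0 ->
  (forall y, mdist (f y) (g y) <= phi y) -> {for x, continuous g}.
Proof.
move=> fx phix phix0 fg_phi.
have fgx : f x = g x.
  apply: mdist_positivity; apply: le_anti.
  by rewrite mdist_ge0 andbT -phix0 fg_phi.
apply/metricType_numDomainType.cvgrPdist_lt => e e0.
have e20 : 0 < e / 2 by rewrite divr_gt0.
have /metricType_numDomainType.cvgrPdist_lt /(_ _ e20) near_f := fx.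
have /cvgrPdist_lt /(_ _ e20) near_phi := phix.
near=> y.
rewrite -fgx (le_lt_trans (metric_triangle _ (f y) _))// [ltRHS]splitr.
rewrite ltrD//; first by near: y.
rewrite (le_lt_trans (fg_phi y))// (le_lt_trans (ler_norm _))//.
(* Since [phi x = 0], the norm of [phi y] is that of [phi x - phi y], which [near_phi] controls. *)
by rewrite -normrN -sub0r -phix0; near: y.
Unshelve. all: by end_near. Qed.

(** Neighborhoods in an open [A] of a point of [A] are also neighborhoods in [X]. *)
Lemma open_sigL_continuous (X Y : topologicalType) (A : set X) (g : X -> Y)
    (x : X) : open A -> continuous (sigL A g) -> A x -> {for x, continuous g}.
Proof.
move=> oA /subspace_sigL_continuousP; rewrite continuous_open_subspace// => gA.
by move=> Ax; apply: gA; rewrite inE.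
Qed.

Theorem proposition4p1 (R : realType) (X : topologicalType)
    (hX : perfectly_normal R X) (C : set X) (hC : closed C)
    (p : nat) (Y : metricType R) (hY : manifold R p Y)
    (Z : set Y) (hZ : avoidable (set_type (~` C)) Z)
    (f : X -> Y) (hf : continuous f)
    (eps : X -> R) (heps : continuous eps) (eps_gt0 : forall x, 0 < eps x)
    (hfC : forall x, C x -> ~ Z (f x)) :
  exists g : X -> Y,
    [/\ continuous g,
        forall x, C x -> g x = f x &
        forall x, ~ Z (g x) /\ mdist (f x) (g x) < eps x].
Proof.
have [phi [phic phi_ge0 phi0]] := perfectly_normal_closed_zero hX hC.
have oC : open (~` C) by exact: closed_openC.
have valc : continuous (set_val : set_type (~` C) -> X).
  exact: initial_continuous.
have valNC (u : set_type (~` C)) : ~ C (set_val u).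
  by have := set_valP u.
pose r (u : set_type (~` C)) := Num.min (eps (set_val u)) (phi (set_val u)).
have rc : continuous r.
  move=> u; apply: continuous_min; apply: continuous_comp (valc u) _.
    exact: heps.
  exact: phic.
have r_gt0 u : 0 < r u.
  rewrite lt_min eps_gt0 lt_neqAle phi_ge0 andbT eq_sym.
  by apply/eqP => /phi0; exact: valNC.
have fvalc : continuous (f \o (set_val : set_type (~` C) -> X)).
  by move=> u; apply: continuous_comp (valc u) _; exact: hf.
have [h hc hP] := hZ _ _ fvalc rc r_gt0.
(* The case split supplies the membership proof needed to view [x] as a point of the subtype on
   which [h] is defined. *)
pose g x := if pselect ((~` C) x) is left nCx then h (SigSub (mem_set nCx))
            else f x.
have gC x : C x -> g x = f x by rewrite /g; case: pselect.
have g_val u : g (set_val u) = h u.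
  rewrite /g; case: pselect => [nCu|/(_ (valNC u))//].
  by congr h; apply: val_inj.
have gNC x : ~ C x -> ~ Z (g x) /\ mdist (f x) (g x) < Num.min (eps x) (phi x).
  move=> nCx; have nCx' : x \in ~` C by rewrite inE.
  by have := hP (SigSub nCx'); rewrite -g_val.
(* The bound must hold on all of [X], as a neighborhood of a point of [C] may meet both [C] and its
   complement. *)
have fg_phi x : mdist (f x) (g x) <= phi x.
  have [Cx|/gNC[_]] := pselect (C x); first by rewrite gC// mdistxx.
  by rewrite lt_min => /andP[_ /ltW].
(* Continuity comes first, by squeezing on [C] and from [h] off [C]; avoidance of [Z] with the [eps]
   bound follows, in the same two cases. *)
exists g; split => // x; have [Cx|nCx] := pselect (C x).
- by apply: (mdist_squeeze_continuous (hf x) (phic x)) => //; exact/phi0.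
- apply: (open_sigL_continuous oC) => //.
  by rewrite (_ : sigL _ g = h)//; apply/funext => u; rewrite -g_val.
- by rewrite gC// mdistxx; split => //; exact: hfC.
- by have [nZ] := gNC x nCx; rewrite lt_min => /andP[].
Qed.
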